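(* Let $\{(x^k,\lambda^k)\}\subset X\times H$ be an infinite sequence generated by the safeguarded augmented Lagrangian method (ALM) described in the context, and suppose that the subproblems are solved in such a way that there is a sequence $\{\varepsilon^k\}\subset X^*$ with $\varepsilon^k\rightharpoonup^*0$, $x^{k+1}\in C$ and $\varepsilon^{k+1}-(L_{\rho^k})'_x(x^{k+1},w^k)\in\mathcal N_C(x^{k+1})$ for all $k\ge0$. Then $\{(x^k,\lambda^k)\}_{k\ge1}\subset X\times H$ is a w-AKKT sequence of the problem $(P_H)$: minimize $f(x)$ over $x\in C$ subject to $e(G(x))\in\mathcal K$ (and, in particular, viewing $\{(x^k,\lambda^k)\}_{k\ge1}\subset X\times Y^*$, also a w-AKKT sequence of the problem $(P)$: minimize $f(x)$ over $x\in C$ subject to $G(x)\in K$).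
   Context: Setting: $X$ and $Y$ are real Banach spaces, $f\colon X\to\mathbb R$ and $G\colon X\to Y$ are continuously Fréchet differentiable, $C\subset X$ and $K\subset Y$ are nonempty, closed, convex sets. $H$ is a real Hilbert space (identified with its dual), $e\colon Y\to H$ is a continuous dense embedding, giving $Y\hookrightarrow H=H^*\hookrightarrow Y^*$ (so $\lambda\in H$ acts on $Y$ by $\langle\lambda,y\rangle_Y=(\lambda,e(y))_H$), and $\mathcal K\subset H$ is a closed convex set with $e^{-1}(\mathcal K)=K$. The embedding $e$ is omitted from the notation below. $d_{\mathcal K}$ and $P_{\mathcal K}$ denote the distance function and projection of $\mathcal K$ in $H$. $\mathcal N_C(x):=\{v\in X^*\mid\langle v,z-x\rangle_X\le0\ \forall z\in C\}$ for $x\in C$, $\mathcal N_C(x):=\varnothing$ otherwise. Augmented Lagrangian: for $\rho>0$, $x\in X$, $\lambda\in H$, $L_\rho(x,\lambda):=f(x)+\frac\rho2 d_{\mathcal K}^2\left(G(x)+\frac\lambda\rho\right)-\frac{\|\lambda\|_H^2}{2\rho}$. Put $V(x,\lambda,\rho):=\|G(x)-P_{\mathcal K}(G(x)+\rho^{-1}\lambda)\|_H$. ALM: given $(x^0,\lambda^0)\in X\times H$, $\rho^0>0$, a nonempty bounded set $B\subset H$, $\gamma>1$, $\tau\in(0,1)$. For $k=0,1,2,\dots$: (the iteration is assumed not to terminate) choose $w^k\in B$ and compute an approximate solution $x^{k+1}$ of the subproblem: minimize $L_{\rho^k}(x,w^k)$ over $x\in C$; set $\lambda^{k+1}:=\rho^k\left[G(x^{k+1})+\frac{w^k}{\rho^k}-P_{\mathcal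 K}\left(G(x^{k+1})+\frac{w^k}{\rho^k}\right)\right]$; let $V^{k+1}:=V(x^{k+1},w^k,\rho^k)$ and set $\rho^{k+1}:=\rho^k$ if $k=0$ or $V^{k+1}\le\tau V^k$, and $\rho^{k+1}:=\gamma\rho^k$ otherwise. w-AKKT sequences: a sequence $\{(x^k,\lambda^k)\}\subset C\times Y^*$ is a w-AKKT sequence of $(P)$ if there are $\{\varepsilon^k\}\subset X^*$ with $\varepsilon^k\rightharpoonup^*0$ and $\{r^k\}\subset[0,+\infty)$ with $r^k\to0$ such that for all $k$: $\varepsilon^k-f'(x^k)-G'(x^k)^*\lambda^k\in\mathcal N_C(x^k)$ and $\langle\lambda^k,y-G(x^k)\rangle_Y\le r^k$ for all $y\in K$. A w-AKKT sequence of $(P_H)$ is defined in the same way with $Y$, $K$, $G$ replaced by $H$, $\mathcal K$, $e\circ G$. *)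

(* Defs.v *)
From HB Require Import structures.
From mathcomp Require Import all_boot all_order all_algebra.
From mathcomp Require Import all_classical all_reals all_analysis.

Set Implicit Arguments.
Unset Strict Implicit.
Unset Printing Implicit Defensive.

Import Order.TTheory GRing.Theory Num.Theory.
Import numFieldNormedType.Exports.

Local Open Scope classical_set_scope.
Local Open Scope ring_scope.

Section duality.
Context {R : realType} {E : normedModType R}.

(* The dual space is a set of plain functions, so that its elements can be
   combined pointwise ([\-], [\o]) and tested for membership afterwards. *)
Definition dual_space : set (E -> R) := [set phi | linear phi /\ continuous phi].

Definition weak_star_cvg (phi : nat -> E -> R) (psi : E -> R) : Prop :=
  forall h : E, phi k h @[k --> \oo] --> psi h.

Definition normal_cone (C : set E) (x : E) : set (E -> R) :=
  [set v | [/\ C x, dual_space v & forall z, C z -> v (z - x) <= 0]].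

End duality.

Section smoothness.
Context {R : realType} {E F : normedModType R}.

(* [sup] is 0 on unbounded sets: meaningful for bounded linear [A] only. *)
Definition opnorm (A : E -> F) : R := sup [set `|A h| | h in [set h | `|h| <= 1]].

Definition continuously_differentiable (Phi : E -> F) : Prop :=
  (forall x, differentiable Phi x) /\
  (forall x, opnorm ('d Phi y \- 'd Phi x) @[y --> x] --> 0).

End smoothness.

Section projection.
Context {R : realType} {H : normedModType R}.

Definition set_dist (A : set H) (y : H) : R := inf [set `|y - z| | z in A].

Definition metric_proj (A : set H) (y : H) : H :=
  get [set p | A p /\ `|y - p| = set_dist A y].

End projection.

Section ALM.
Context {R : realType} {X H : normedModType R}.
(* [g] stands for the constraint map with values in the pivot space [H]. *)
Variables (f : X -> R) (g : X -> H) (A : set H).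

Definition aug_lagrangian (rho : R) (x : X) (lam : H) : R :=
  f x + rho / 2 * set_dist A (g x + rho^-1 *: lam) ^+ 2 - `|lam| ^+ 2 / (2 * rho).

Definition ALM_residual (x : X) (lam : H) (rho : R) : R :=
  `|g x - metric_proj A (g x + rho^-1 *: lam)|.

(* The notion of approximate solution of the subproblems is left open: the
   inexactness criterion on [x k.+1] has to be stated separately. In the penalty
   update, [ALM_residual (x k) (w k.-1) (rho k.-1)] is only used for [0 < k]. *)
Record safeguarded_ALM (B : set H) (gamma tau : R)
    (x : nat -> X) (lam w : nat -> H) (rho : nat -> R) : Prop := {
  ALM_B_nonempty : B !=set0 ;
  ALM_B_bounded : bounded_set B ;
  ALM_gamma : 1 < gamma ;
  ALM_tau : 0 < tau < 1 ;
  ALM_rho0 : 0 < rho 0%N ;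
  ALM_safeguard : forall k, B (w k) ;
  ALM_multiplier : forall k, lam k.+1 =
    rho k *: (g (x k.+1) + (rho k)^-1 *: w k
              - metric_proj A (g (x k.+1) + (rho k)^-1 *: w k)) ;
  ALM_penalty : forall k, rho k.+1 =
    if (k == 0%N) || (ALM_residual (x k.+1) (w k) (rho k) <=
                      tau * ALM_residual (x k) (w k.-1) (rho k.-1))
    then rho k else gamma * rho k }.

End ALM.

(* w-AKKT sequences of: minimize f x over x in C subject to G x in K. The
   composition [lam k \o 'd G (x k)] is the adjoint of G'(x^k) applied to
   lambda^k. *)
Definition w_AKKT_sequence {R : realType} {X Y : normedModType R}
    (f : X -> R) (G : X -> Y) (C : set X) (K : set Y)
    (x : nat -> X) (lam : nat -> Y -> R) : Prop :=
  (forall k, C (x k) /\ dual_space (lam k)) /\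
  exists (eps : nat -> X -> R) (r : nat -> R),
    [/\ (forall k, dual_space (eps k)) /\ weak_star_cvg eps (cst 0),
        (forall k, 0 <= r k) /\ r @ \oo --> 0,
        forall k, normal_cone C (x k)
          (eps k \- 'd f (x k) \- (lam k \o 'd G (x k))) &
        forall k y, K y -> lam k (y - G (x k)) <= r k].

(* Main.v *)
Require Import Defs.
From HB Require Import structures.
From mathcomp Require Import all_boot all_order all_algebra.
From mathcomp Require Import all_classical all_reals all_analysis.
From mathcomp Require Import ring lra.

Set Implicit Arguments.
Unset Strict Implicit.
Unset Printing Implicit Defensive.

Import Order.TTheory GRing.Theory Num.Theory.
Import numFieldNormedType.Exports.

Local Open Scope classical_set_scope.
Local Open Scope ring_scope.

(* Since P is the nearest-point projection in a Hilbert space, d^2 has the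
   derivative 2 (u - P u, .), so L'_x(x^{k+1}, w^k) = f' + G'^* lambda^{k+1} and
   the stationarity of x^{k+1} is exactly the first AKKT condition. For the second
   one, the variational inequality of P bounds (lambda, y - G) over calK by
   (lambda, p - G), where p = P(G + w / rho) and lambda = w + rho (G - p). This is
   at most |w|^2 / (4 rho) by completing the square, and at most
   (|w| + rho V) V by Cauchy-Schwarz. Either rho^k tends to infinity and the first
   bound vanishes, or rho^k is eventually constant, so that V^k decays
   geometrically and the second one does. *)

(** * Inner products that induce the norm *)

Section inner_product.
Context {R : realType} {H : normedModType R} (dot : {dot H for (@idfun R)}).
Implicit Types u v h : H.

Lemma dotC u v : dot u v = dot v u.
Proof. by rewrite hermC expr0 mul1r. Qed.

Lemma dotDl u v h : dot (u + v) h = dot u h + dot v h.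
Proof. by rewrite linearDl. Qed.

Lemma dotZl (a : R) u h : dot (a *: u) h = a * dot u h.
Proof. by rewrite linearZl_LR. Qed.

Lemma dotNl u h : dot (- u) h = - dot u h.
Proof. by rewrite linearNl. Qed.

Lemma dotDr u v h : dot h (u + v) = dot h u + dot h v.
Proof. by rewrite !(dotC h) dotDl. Qed.

Lemma dotZr (a : R) u h : dot h (a *: u) = a * dot h u.
Proof. by rewrite !(dotC h) dotZl. Qed.

Lemma dotNr u h : dot h (- u) = - dot h u.
Proof. by rewrite !(dotC h) dotNl. Qed.

Hypothesis dot_norm : forall h, dot h h = `|h| ^+ 2.

Lemma sqr_normD u v : `|u + v| ^+ 2 = `|u| ^+ 2 + `|v| ^+ 2 + 2 * dot u v.
Proof. by rewrite -!dot_norm dotDl !dotDr (dotC v u); ring. Qed.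

(** Cauchy-Schwarz follows from the triangle inequality: square it and compare the cross terms. *)
Lemma dot_le u v : dot u v <= `|u| * `|v|.
Proof.
have : `|u + v| ^+ 2 <= (`|u| + `|v|) ^+ 2.
  by rewrite lerXn2r ?nnegrE ?addr_ge0// ler_normD.
by rewrite sqr_normD; lra.
Qed.

Lemma norm_dot_le u v : `|dot u v| <= `|u| * `|v|.
Proof.
by rewrite ler_norml dot_le andbT lerNl -dotNl (le_trans (dot_le _ _))// normrN.
Qed.

Lemma linear_dot u : linear (dot u).
Proof. by move=> a v h; rewrite dotDr dotZr. Qed.

Lemma continuous_dot u : continuous (dot u).
Proof.
apply/linear_bounded_continuous/ex_bound; exists `|u|.
near=> v => /=; rewrite (le_trans (norm_dot_le _ _))// ler_piMr//.
Unshelve. all: end_near. Qed.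

Lemma dual_space_dot u : dual_space (dot u).
Proof. by split; [exact: linear_dot | exact: continuous_dot]. Qed.

End inner_product.

(** A quadratic remainder is o(h), and a continuous linear map with such a remainder is the
    differential, by uniqueness. *)
Lemma is_diff_quadratic_remainder (R : realType) (V W : normedModType R)
    (f : V -> W) (df : {linear V -> W}) (x : V) : continuous df ->
  (forall h, `|f (x + h) - f x - df h| <= `|h| ^+ 2) -> is_diff x f df.
Proof.
move=> df_cont fdf.
have fE : f \o shift x = cst (f x) + df +o_ 0 id.
  apply/eqaddoP => e e0; near=> h.
  rewrite -[leLHS]/(`|f (h + x) - (f x + df h)|) opprD addrA [h + x]addrC.
  rewrite (le_trans (fdf h))// expr2 ler_wpM2r//.
have dE := diff_unique df_cont fE.
by apply: DiffDef => //; apply/diff_locallyP; rewrite dE.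
Unshelve. all: end_near. Qed.

(** * Metric projection onto a closed convex set, and the derivative of the squared distance *)

Section projection.
Context {R : realType} {H : completeNormedModType R}.
Variable dot : {dot H for (@idfun R)}.
Hypothesis dot_norm : forall h : H, dot h h = `|h| ^+ 2.
Variable A : set H.
Implicit Types u v y z h : H.

(** Convexity in [convex_set] uses weights of a bundled interval type; this form takes a plain real
    parameter. *)
Lemma convex_set_segment z y (t : R) : convex_set A -> A z -> A y ->
  0 <= t <= 1 -> A (z + t *: (y - z)).
Proof.
move=> cA Az Ay /andP[t0 t1].
have t01 : Itv.spec (@Itv.num_sem R) (Itv.Real `[0%Z, 1%Z]) t.
  by apply/and3P; split; rewrite /= ?bnd_simp// ?num_real.
pose i : {i01 R} := Itv.mk t01.
have := cA y z i (mem_set Ay) (mem_set Az); rewrite inE.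
by congr A; rewrite /conv/= scalerBl scale1r scalerBr addrCA addrA addrC.
Qed.

Lemma set_dist_has_inf y : A !=set0 -> has_inf [set `|y - z| | z in A].
Proof.
by move=> [z Az]; split; [exists `|y - z|, z | exists 0 => _ [v _ <-]].
Qed.

Lemma set_dist_ge0 y : A !=set0 -> 0 <= set_dist A y.
Proof.
by move=> [z Az]; apply: lb_le_inf; [exists `|y - z|, z | move=> _ [v _ <-]].
Qed.

Lemma set_dist_le y z : A z -> set_dist A y <= `|y - z|.
Proof.
by move=> Az; apply: ge_inf; [exists 0 => _ [v _ <-] | exists z].
Qed.

(** The excess is measured on squared distances because the parallelogram estimate takes it in that
    form. *)
Lemma set_dist_adherent y (r : R) : A !=set0 -> 0 < r ->
  exists2 z, A z & `|y - z| ^+ 2 < set_dist A y ^+ 2 + r.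
Proof.
move=> A0 r0; have d0 := set_dist_ge0 y A0.
set d := set_dist A y in d0 *.
have dr : d < Num.sqrt (d ^+ 2 + r).
  by rewrite -{1}(ger0_norm d0) -(sqrtr_sqr d) ltr_sqrt; nra.
move: dr; rewrite -subr_gt0 => /inf_adherent/(_ (set_dist_has_inf y A0)).
rewrite -/(set_dist A y) addrC subrK => -[_ [z Az <-] yz]; exists z => //.
by rewrite -[ltRHS]sqr_sqrtr ?ltrXn2r// ?nnegrE; nra.
Qed.

Hypotheses (A0 : A !=set0) (A_closed : closed A) (A_convex : convex_set A).

(* Parallelogram law for y - z and y - v, whose midpoint is at distance at least
   [set_dist A y] from 0: minimizing sequences are Cauchy. *)
Lemma convex_set_parallelogram y z v : A z -> A v ->
  `|z - v| ^+ 2 <= 2 * (`|y - z| ^+ 2 - set_dist A y ^+ 2) +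
                   2 * (`|y - v| ^+ 2 - set_dist A y ^+ 2).
Proof.
move=> Az Av.
have Am : A (z + 2^-1 *: (v - z)) by apply: convex_set_segment => //; lra.
have : set_dist A y ^+ 2 <= `|y - (z + 2^-1 *: (v - z))| ^+ 2.
  by rewrite lerXn2r ?nnegrE ?set_dist_ge0 ?set_dist_le.
rewrite -!dot_norm !(dotDl, dotDr, dotNl, dotNr, dotZl, dotZr).
by rewrite (dotC dot z y) (dotC dot v y) (dotC dot z v); lra.
Qed.

(** A minimizing sequence is Cauchy by the parallelogram estimate. Its limit lies in the closed set
    [A] and attains the distance. *)
Lemma metric_proj_exists y : exists p, A p /\ `|y - p| = set_dist A y.
Proof.
have /choice[z zP] (n : nat) : exists z,
    A z /\ `|y - z| ^+ 2 < set_dist A y ^+ 2 + n.+1%:R^-1.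
  by have [z] := set_dist_adherent y A0 (harmonic_gt0 n); exists z.
have zA n : A (z n) by have [] := zP n.
have cz : cvg (z @ \oo).
  apply/cauchy_cvgP/cauchy_exP => e e0.
  (* Two squared excesses below e^2 / 4, each doubled by the parallelogram estimate, add up to less
     than e^2. *)
  have [N _ NP] : \forall n \near \oo, n.+1%:R^-1 < e ^+ 2 / 4.
    by apply: (cvgr_lt _ (@cvg_harmonic R)); nra.
  exists (z N); exists N => // n /= Nn.
  rewrite -ball_normE/= -(ltr_pXn2r (n:=2)) ?nnegrE//; last exact: ltW.
  have := NP N (leqnn N); have := NP n Nn; have [_] := zP N; have [_] := zP n.
  have := convex_set_parallelogram y (zA N) (zA n).
  by rewrite /=; move: (n.+1%:R^-1) (N.+1%:R^-1) => ? ?; lra.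
have zl : z @ \oo --> lim (z @ \oo) by [].
exists (lim (z @ \oo)); split.
  by apply: (closed_cvg _ A_closed _ _ zl); apply: nearW.
apply/eqP; rewrite eq_le set_dist_le ?andbT; last first.
  by apply: (closed_cvg _ A_closed _ _ zl); apply: nearW.
rewrite -(ler_pXn2r (n:=2)) ?nnegrE ?set_dist_ge0//.
have yz : `|y - z n| ^+ 2 @[n --> \oo] --> `|y - lim (z @ \oo)| ^+ 2.
  by apply: cvgM; apply: cvg_norm; apply: cvgB => //; exact: cvg_cst.
rewrite -[leRHS]addr0.
apply: (ler_cvg_to yz (cvgD (cvg_cst _) (@cvg_harmonic R))).
by apply: nearW => n; exact: ltW (zP n).2.
Qed.

Lemma metric_projP y :
  A (metric_proj A y) /\ `|y - metric_proj A y| = set_dist A y.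
Proof. exact: getPex (metric_proj_exists y). Qed.

(** Were the product positive, a short step from the projection towards [z] would stay in [A] and
    come closer to [y]. *)
Lemma metric_proj_variational y z : A z ->
  dot (y - metric_proj A y) (z - metric_proj A y) <= 0.
Proof.
move=> Az; have [Ap dp] := metric_projP y.
set p := metric_proj A y in Ap dp *.
set a := dot _ _; rewrite leNgt; apply/negP => a0.
set b := `|z - p| ^+ 2; have b0 : 0 <= b by rewrite exprn_ge0.
(* a step length t in (0, 1] with t * b <= a, hence -2 t a + t^2 b < 0 *)
pose t := a / (a + b).
have tab : t * (a + b) = a by rewrite /t mulfVK//; lra.
have t01 : 0 < t <= 1.
  by rewrite /t divr_gt0 ?ler_pdivrMr; lra.
have At : A (p + t *: (z - p)) by apply: convex_set_segment => //; lra.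
have : `|y - p| ^+ 2 <= `|y - p + (- t) *: (z - p)| ^+ 2.
  rewrite lerXn2r ?nnegrE// dp scaleNr -addrA -opprD; exact: set_dist_le.
rewrite (sqr_normD dot_norm (y - p)) dotZr -/a.
rewrite normrZ exprMn normrN real_normK ?num_real// -/b.
nra.
Qed.

(** The variational inequalities at [u] and [v], each tested with the other projection, add up to
    |Pu - Pv|^2 <= (u - v, Pu - Pv); Cauchy-Schwarz concludes. *)
Lemma metric_proj_nonexpansive u v :
  `|metric_proj A u - metric_proj A v| <= `|u - v|.
Proof.
have [Ap _] := metric_projP u; have [Aq _] := metric_projP v.
have := metric_proj_variational u Aq; have := metric_proj_variational v Ap.
move: (metric_proj A u) (metric_proj A v) => p q {Ap Aq}.
set d := p - q => h1; rewrite -[q - p]opprB -/d dotNr => h2.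
have : `|d| ^+ 2 <= dot (u - v) d.
  have := dotDl dot p (- q) d; rewrite -/d dot_norm => ->; move: h1 h2.
  by rewrite !(dotDl, dotNl); lra.
move/le_trans => /(_ _ (dot_le dot_norm _ _)).
have := normr_ge0 d; have := normr_ge0 (u - v); move: `|d| => x.
nra.
Qed.

(** The upper bound tests the distance at [u + h] with Pu, the lower bound tests the distance at [u]
    with P(u + h). The latter leaves the term (P(u + h) - Pu, h), at most |h|^2 by
    nonexpansiveness. *)
Lemma set_dist_sqr_expansion u h :
  `|set_dist A (u + h) ^+ 2 - set_dist A u ^+ 2
    - 2 * dot (u - metric_proj A u) h| <= `|h| ^+ 2.
Proof.
have [Ap dp] := metric_projP u; have [Aq dq] := metric_projP (u + h).
have le1 : set_dist A (u + h) ^+ 2 <= `|u - metric_proj A u + h| ^+ 2.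
  by rewrite lerXn2r ?nnegrE ?set_dist_ge0// addrAC set_dist_le.
have le2 : set_dist A u ^+ 2 <=
    `|(u + h - metric_proj A (u + h)) + (- h)| ^+ 2.
  by rewrite lerXn2r ?nnegrE ?set_dist_ge0// addrAC addrK set_dist_le.
have : dot (metric_proj A (u + h) - metric_proj A u) h <= `|h| ^+ 2.
  rewrite (le_trans (dot_le dot_norm _ _))// expr2 ler_wpM2r//.
  by rewrite (le_trans (metric_proj_nonexpansive _ _))// addrAC subrr add0r.
move: le1 le2; rewrite !(sqr_normD dot_norm (_ - metric_proj _ _)).
rewrite dp dq normrN dotNr.
have := dot_norm h.
rewrite !(dotDl, dotNl) ler_norml; lra.
Qed.

Lemma is_diff_set_dist_sqr u :
  is_diff u (fun y => set_dist A y ^+ 2)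
            (fun h => 2 * dot (u - metric_proj A u) h).
Proof.
set w := u - metric_proj A u.
have lin : linear (fun h => 2 * dot w h).
  by move=> a v h; rewrite linear_dot mulrDr scalerAr.
pose linM := GRing.isLinear.Build _ _ _ _ _ lin.
pose L : {linear H -> R} := HB.pack (fun h => 2 * dot w h) linM.
apply: (@is_diff_quadratic_remainder _ _ _ _ L) => [|h]; last first.
  exact: set_dist_sqr_expansion.
by move=> h; apply: cvgM; [exact: cvg_cst | exact: continuous_dot].
Qed.

End projection.

Section safeguarded_ALM_multipliers.
Context {R : realType} {X : normedModType R} {H : completeNormedModType R}.
Context (dot : {dot H for (@idfun R)}).
Hypothesis dot_norm : forall h : H, dot h h = `|h| ^+ 2.
Variables (f : X -> R) (g : X -> H) (A B : set H).
Hypotheses (A0 : A !=set0) (A_closed : closed A) (A_convex : convex_set A).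

(** Chain rule; at [l = w k] and [x k.+1], with penalty [rho k], the vector paired by [dot] is the
    updated multiplier [lam k.+1]. *)
Lemma diff_aug_lagrangian (rho : R) (x : X) (l : H) :
  differentiable f x -> differentiable g x ->
  'd (fun z => aug_lagrangian f g A rho z l) x =
  'd f x \+ (dot (rho *: (g x + rho^-1 *: l
                          - metric_proj A (g x + rho^-1 *: l))) \o 'd g x)
  :> (X -> R).
Proof.
move=> /differentiableP df /differentiableP dg.
set u := g x + rho^-1 *: l.
have dgl : is_diff x (fun z => g z + rho^-1 *: l) ('d g x).
  by apply: is_diff_eq (is_diffD dg (is_diff_cst _ x)) _; rewrite addr0.
have dd : is_diff x (fun z => set_dist A (g z + rho^-1 *: l) ^+ 2)
    (fun h => 2 * dot (u - metric_proj A u) ('d g x h)).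
  have du := is_diff_set_dist_sqr dot_norm A0 A_closed A_convex u.
  exact: (is_diff_comp dgl du).
have dL : is_diff x (fun z => aug_lagrangian f g A rho z l)
    (('d f x : X -> R) +
     (rho / 2) *: (fun h : X => 2 * dot (u - metric_proj A u) ('d g x h)) - 0).
  exact: (is_diffB (is_diffD df (is_diffZ (rho / 2) dd)) (is_diff_cst _ x)).
rewrite diff_val; apply/funext => h; rewrite /= subr0 dotZl.
rewrite -[LHS]/('d f x h + rho / 2 * (2 * dot (u - metric_proj A u) ('d g x h))).
by rewrite [in LHS]mulrA divfK.
Qed.

Variables (gamma tau : R) (x : nat -> X) (lam w : nat -> H) (rho : nat -> R).
Hypothesis ALM : safeguarded_ALM g A B gamma tau x lam w rho.

(* [V k] is the paper's V^{k+1}. *)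
Let V k := ALM_residual g A (x k.+1) (w k) (rho k).

Lemma ALM_rho_gt0 k : 0 < rho k.
Proof.
elim: k => [|k IHk]; first exact: ALM_rho0 ALM.
rewrite (ALM_penalty ALM); case: ifP => // _.
by rewrite mulr_gt0// (lt_trans _ (ALM_gamma ALM)).
Qed.

Lemma ALM_rho_nondecreasing : nondecreasing_seq rho.
Proof.
apply/nondecreasing_seqP => k; rewrite (ALM_penalty ALM); case: ifP => // _.
by rewrite ler_peMl ?(ltW (ALM_rho_gt0 k)) ?(ltW (ALM_gamma ALM)).
Qed.

(** As [gamma > 1] and [rho > 0], an unchanged penalty means that the test succeeded; the index
    [k.+2] avoids the unconditional first update. *)
Lemma ALM_residual_decrease k : rho k.+2 = rho k.+1 -> V k.+1 <= tau * V k.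
Proof.
rewrite (ALM_penalty ALM)/=; case: ifP => // _ /eqP.
rewrite -subr_eq0 -{2}[rho k.+1]mul1r -mulrBl mulf_eq0 subr_eq0.
by rewrite !gt_eqF ?ALM_rho_gt0 ?(ALM_gamma ALM).
Qed.

Lemma ALM_rho_dichotomy :
  (exists N, forall k, rho (k + N)%N = rho N) \/ rho @ \oo --> +oo.
Proof.
have [|rho_increases] := pselect (exists N, forall k, rho (k + N)%N = rho N).
  by left.
(* [c] bounds every increase from below: one at [k] adds [(gamma - 1) * rho k], and [rho] is
   nondecreasing. *)
right; pose c := (gamma - 1) * rho 0%N.
have c0 : 0 < c by rewrite mulr_gt0 ?subr_gt0 ?(ALM_gamma ALM) ?ALM_rho_gt0.
have step N : exists k, rho N + c <= rho k.
  (* If [rho N + c] is never reached, no update from [N] on multiplies by [gamma], so [rho] is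
     constant from there. *)
  apply: contrapT => noN; apply: rho_increases; exists N.
  elim=> // k IHk; rewrite addSn (ALM_penalty ALM) -IHk; case: ifP => // cond.
  exfalso; apply: noN; exists (k + N).+1; rewrite (ALM_penalty ALM) cond -IHk.
  have := ALM_rho_nondecreasing (leq0n (k + N)).
  have := ALM_gamma ALM; rewrite /c; nra.
have unbounded j : exists k, arithmetic (rho 0%N) c j <= rho k.
  elim: j => [|j [n jn]]; first by exists 0%N; rewrite /= addr0.
  have [k nk] := step n; exists k; apply: le_trans nk.
  by rewrite /= mulrSr addrA lerD2r.
apply/cvgryPge => a.
have [N _ /(_ N (leqnn N)) aN] :=
  (cvgryPge _).1 (cvg_arithmetic (rho 0%N) c0) a.
have [k Nk] := unbounded N; exists k => // n /= kn.
by rewrite (le_trans aN) ?(le_trans Nk)// ALM_rho_nondecreasing.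
Qed.

Let p k := metric_proj A (g (x k.+1) + (rho k)^-1 *: w k).

Lemma ALM_multiplier_residualE k :
  lam k.+1 = w k + rho k *: (g (x k.+1) - p k).
Proof.
rewrite (ALM_multiplier ALM) -/(p k) addrAC scalerDr scalerA.
by rewrite divff ?gt_eqF ?ALM_rho_gt0// scale1r [LHS]addrC.
Qed.

(** The multiplier is a positive multiple of u - Pu, so the variational inequality of the projection
    applies. *)
Lemma ALM_multiplier_le k y : A y -> dot (lam k.+1) (y - g (x k.+1)) <=
  dot (lam k.+1) (p k - g (x k.+1)).
Proof.
move=> Ay; rewrite -subr_ge0 -dotNr -dotDr opprB addrA subrK.
rewrite -[p k - y]opprB dotNr oppr_ge0 (ALM_multiplier ALM) dotZl.
by rewrite pmulr_rle0 ?ALM_rho_gt0//; exact: metric_proj_variational.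
Qed.

Lemma ALM_multiplier_gap_le_rho k :
  dot (lam k.+1) (p k - g (x k.+1)) <= `|w k| ^+ 2 / (4 * rho k).
Proof.
have r0 := ALM_rho_gt0 k.
rewrite ler_pdivlMr ?mulr_gt0// -[p k - _]opprB.
have := ALM_multiplier_residualE k.
move: (g _ - p k) => q ->.
(* complete the square at the minimizer q = - w / (2 rho) *)
have : 0 <= `|w k + (2 * rho k) *: q| ^+ 2 by rewrite exprn_ge0.
rewrite -!dot_norm !(dotDl, dotDr, dotZl, dotZr, dotNr) (dotC dot q); nra.
Qed.

Lemma ALM_multiplier_gap_le_residual k :
  dot (lam k.+1) (p k - g (x k.+1)) <= (`|w k| + rho k * V k) * V k.
Proof.
have r0 := ALM_rho_gt0 k.
rewrite (le_trans (dot_le dot_norm _ _))//.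
have -> : V k = `|p k - g (x k.+1)| by rewrite distrC.
rewrite ler_wpM2r// ALM_multiplier_residualE (le_trans (ler_normD _ _))//.
by rewrite normrZ gtr0_norm// distrC.
Qed.

(** The gap may be negative; truncating it at 0 gives an admissible [r] for the AKKT condition. *)
Lemma ALM_multiplier_gap_cvg0 :
  Num.max 0 (dot (lam k.+1) (p k - g (x k.+1))) @[k --> \oo] --> 0.
Proof.
have [M M0 BM] : exists2 M, 0 < M & forall k, `|w k| <= M.
  have [M M0 BM] := ex_strict_bound_gt0 (ALM_B_bounded ALM).
  by exists M => // k; apply/ltW/BM; exact: ALM_safeguard ALM k.
have V0 k : 0 <= V k by exact: normr_ge0.
have [[N rhoN]|rhoy] := ALM_rho_dichotomy; last first.
  apply/cvgr0Pnorm_le => e e0; near=> k.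
  have r0 := ALM_rho_gt0 k.
  rewrite ger0_norm ?le_max ?lexx// ge_max (ltW e0)/=.
  rewrite (le_trans (ALM_multiplier_gap_le_rho k))// ler_pdivrMr ?mulr_gt0//.
  (* This threshold makes the bound M^2 / (4 rho) at most [e]. *)
  have : M ^+ 2 / (4 * e) <= rho k by near: k; exact: (cvgryPge _).1.
  rewrite ler_pdivrMr ?mulr_gt0//.
  have : `|w k| ^+ 2 <= M ^+ 2 by rewrite lerXn2r ?nnegrE ?(ltW M0).
  by lra.
have /andP[tau0 tau1] := ALM_tau ALM.
(* With [rho] constant from [N] on, every later test succeeded. *)
have V_geometric n : V (n + N) <= geometric (V N) tau n.
  elim: n => [|n IHn]; first by rewrite /= mulr1.
  have : V (n.+1 + N) <= tau * V (n + N).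
    by apply: ALM_residual_decrease; rewrite -!addSn !rhoN.
  by move/le_trans; apply; rewrite /= exprS mulrCA ler_wpM2l// ltW.
have s0 : geometric (V N) tau n @[n --> \oo] --> 0.
  by apply: cvg_geometric; rewrite gtr0_norm.
rewrite -(cvg_shiftn N) /=.
have bound0 : (M + rho N * geometric (V N) tau n) * geometric (V N) tau n
    @[n --> \oo] --> 0.
  rewrite -[X in _ --> X](mulr0 (M + rho N * 0)).
  exact: (cvgM (cvgD (cvg_cst M) (cvgM (cvg_cst (rho N)) s0)) s0).
apply: squeeze_cvgr (cvg_cst 0) bound0.
apply: nearW => n; have r0 := ALM_rho_gt0 N.
move: (V_geometric n); move: (geometric _ _ n) => s Vs.
have s_ge0 := le_trans (V0 _) Vs; rewrite le_max lexx/= ge_max.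
rewrite mulr_ge0 ?addr_ge0 ?mulr_ge0 ?(ltW M0) ?(ltW r0)//=.
rewrite (le_trans (ALM_multiplier_gap_le_residual _))// rhoN ler_pM//.
  by rewrite addr_ge0 ?mulr_ge0 ?(ltW r0).
by rewrite lerD// ler_wpM2l ?(ltW r0).
Unshelve. all: end_near. Qed.

End safeguarded_ALM_multipliers.

Theorem theorem7p5 (R : realType) (X Y H : completeNormedModType R)
  (dot : {dot H for (@idfun R)})
  (dot_norm : forall h : H, dot h h = `|h| ^+ 2)
  (e : {linear Y -> H})
  (e_cont : continuous e) (e_inj : injective e) (e_dense : dense (range e))
  (f : X -> R) (G : X -> Y)
  (f_C1 : continuously_differentiable f) (G_C1 : continuously_differentiable G)
  (C : set X) (K : set Y) (calK : set H)
  (C0 : C !=set0) (C_closed : closed C) (C_convex : convex_set C)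
  (K0 : K !=set0) (K_closed : closed K) (K_convex : convex_set K)
  (calK_closed : closed calK) (calK_convex : convex_set calK)
  (calK_K : e @^-1` calK = K)
  (B : set H) (gamma tau : R)
  (x : nat -> X) (lam w : nat -> H) (rho : nat -> R)
  (xlam_ALM : safeguarded_ALM (e \o G) calK B gamma tau x lam w rho)
  (eps : nat -> X -> R)
  (eps_dual : forall k, dual_space (eps k)) (eps_cvg : weak_star_cvg eps (cst 0))
  (x_C : forall k, C (x k.+1))
  (x_approx : forall k, normal_cone C (x k.+1)
    (eps k.+1 \-
     'd (fun z => aug_lagrangian f (e \o G) calK (rho k) z (w k)) (x k.+1))) :
  w_AKKT_sequence f (e \o G) C calK (fun k => x k.+1) (fun k => dot (lam k.+1))
  /\
  w_AKKT_sequence f G C K (fun k => x k.+1) (fun k => dot (lam k.+1) \o e).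
Proof.
have calK0 : calK !=set0.
  by have [y Ky] := K0; exists (e y); rewrite -calK_K in Ky.
have G_diff z : differentiable G z by have [] := G_C1.
have f_diff z : differentiable f z by have [] := f_C1.
have e_diff y : differentiable e y by exact: linear_differentiable.
have eG_diff z : differentiable (e \o G) z by exact: differentiable_comp.
pose p k := metric_proj calK ((e \o G) (x k.+1) + (rho k)^-1 *: w k).
pose r k := Num.max 0 (dot (lam k.+1) (p k - (e \o G) (x k.+1))).
have r_ge0 k : 0 <= r k by rewrite le_max lexx.
have r_cvg0 : r @ \oo --> 0.
  exact: (ALM_multiplier_gap_cvg0 dot_norm xlam_ALM).
have lam_le k y : calK y -> dot (lam k.+1) (y - (e \o G) (x k.+1)) <= r k.
  move=> Ky; rewrite le_max orbC.
  by rewrite (ALM_multiplier_le dot_norm calK0 calK_closed calK_convex xlam_ALM).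
have stationary k : normal_cone C (x k.+1)
    (eps k.+1 \- 'd f (x k.+1) \- (dot (lam k.+1) \o 'd (e \o G) (x k.+1))).
  have := x_approx k.
  rewrite (diff_aug_lagrangian dot_norm)// -(ALM_multiplier xlam_ALM).
  by congr normal_cone; apply/funext => h /=; rewrite opprD addrA.
have epsS_cvg : weak_star_cvg (fun k => eps k.+1) (cst 0).
  by move=> h; have := eps_cvg h; rewrite -cvg_shiftS.
split; split.
- by move=> k; split=> //; exact: dual_space_dot.
- by exists (fun k => eps k.+1), r; split.
- move=> k; split=> //; split.
    by move=> a y z; rewrite /= linearP linear_dot.
  move=> y; apply: continuous_comp; first exact: e_cont.
  exact: continuous_dot.
(* The same [eps] and [r] serve in [Y]: the linear map [e] is its own differential, so the adjoint
   terms agree, and [e] maps [K] into [calK]. *)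
- exists (fun k => eps k.+1), r; split=> // [k|k y Ky].
    have := stationary k.
    by rewrite (diff_comp (G_diff _) (e_diff _)) (diff_lin _ e_cont).
  by rewrite /= linearB; apply: lam_le; rewrite -calK_K in Ky.
Qed.
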